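(* Suppose that $1 \leq k \leq n-1$. Let $A \colon \mathbb{R}^{2n} \to \mathbb{R}^{2n}$ be a linear map for which $A^*(\omega^k) = \omega^k$. If $k$ is odd, then $A^*\omega = \omega$, and if $k$ is even, then $A^*\omega = \omega$ or $A^*\omega = -\omega$.
   Context: $\omega = dx^1\wedge dy^1 + \cdots + dx^n\wedge dy^n$ is the standard symplectic form on $\mathbb{R}^{2n}$ (with coordinates $(x_1,\dots,x_n,y_1,\dots,y_n)$), and $\omega^k$ is its $k$-fold wedge power. *)

(* Defs.v *)
From mathcomp Require Import all_boot all_order all_algebra all_fingroup.
From mathcomp Require Import functions reals.

Import GRing.Theory.
Local Open Scope ring_scope.

(* Constant-coefficient p-forms on R^m, as functions of p vectors. The type
   does not record multilinearity or alternation: the forms used below satisfy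
   both by construction. Sums and opposites of forms are the pointwise ones, by
   the zmodType structure that functions provides on functions. *)
Definition form (R : realType) (m p : nat) : Type := ('I_p -> 'rV[R]_m) -> R.

(* Normalized so that (a /\ b)(u, v) = a u * b v - a v * b u for 1-forms. *)
Definition wedge {R : realType} {m p q : nat}
    (a : form R m p) (b : form R m q) : form R m (p + q) :=
  fun v => (p`! * q`!)%:R^-1 *
    \sum_(s : 'S_(p + q)) (-1) ^+ s
      * a (fun i : 'I_p => v (s (lshift q i)))
      * b (fun j : 'I_q => v (s (rshift p j))).

(* The recursive call has degree p + k' * p, which is k'.+1 * p by conversion. *)
Fixpoint wedge_pow {R : realType} {m p : nat} (a : form R m p) (k : nat) :
    form R m (k * p) :=
  match k return form R m (k * p) with
  | 0 => fun=> 1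
  | k'.+1 => wedge a (wedge_pow a k')
  end.

Definition pullback {R : realType} {m m' p : nat}
    (A : {linear 'rV[R]_m -> 'rV[R]_m'}) (a : form R m' p) : form R m p :=
  fun v => a (fun i => A (v i)).

(* R^(2n) is 'rV[R]_(n + n): the x-coordinates come first, then the y's. *)
Definition dx (R : realType) (n : nat) (i : 'I_n) : form R (n + n) 1 :=
  fun v => v ord0 ord0 (lshift n i).

Definition dy (R : realType) (n : nat) (i : 'I_n) : form R (n + n) 1 :=
  fun v => v ord0 ord0 (rshift n i).

Definition omega (R : realType) (n : nat) : form R (n + n) 2 :=
  \sum_(i < n) wedge (dx R n i) (dy R n i).

(* Main.v *)
Require Import Defs.
From mathcomp Require Import all_boot all_order all_algebra.
From mathcomp Require Import functions reals.
From mathcomp Require Import all_fingroup boolp.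

(** Write [w] for the standard symplectic form and [w'] for its pullback by [A].
    Up to the factor [2 ^ k], the form [w^k] is the signed sum
    [pfaffian_sum w k] of the products
    [w (v_0, v_1) w (v_2, v_3) ... w (v_(2k-2), v_(2k-1))] over all reorderings
    of the arguments, that is, a multiple of the Pfaffian of the Gram matrix of
    [w]; so the hypothesis is that [w] and [w'] have equal Pfaffian sums of
    order [k].

    The heart of the proof is that orthogonality to a nondegenerate [2k]-tuple
    passes from [w] to [w'] ([pfaffian_sum_transfer]).  Suppose that [w^k] does
    not vanish on [v_0, ..., v_(2k-1)] and that [y] is [w]-orthogonal to each
    [v_i].  Expand [w'^(k+1)] at [(v_i, y, v_0, ..., v_(2k-1))] along its first
    argument ([pfaffian_sum_expand]).  The total is zero since [v_i] occurs
    twice.  The minors are values of [w'^k = w^k]; all those containing [y]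
    vanish, since [y] is [w]-orthogonal to the other arguments, so only
    [w' (v_i, y) w^k (v_0, ..., v_(2k-1))] remains and [w' (v_i, y) = 0].

    Because [k < n], there is room for a symplectic frame of [k] pairs in the
    orthogonal of a suitable [y].  With [y] the basis vector [e_p] or [f_p] and
    the frame made of [k] other pairs [(e_i, f_i)], the Gram matrix of [w'] is
    seen to vanish wherever that of [w] does.  With [y = f_q - f_p] and a frame
    starting with [(e_q + e_p, f_q)], the entries [w' (e_p, f_p)] and
    [w' (e_q, f_q)] agree.  Hence [w' = c w] for a scalar [c]
    ([proportional_of_pfaffian_sum_eq]); comparing [k]-th powers on a frame
    gives [c ^ k = 1], so [c = 1], or [c = -1] with [k] even. *)

Import Order.TTheory GRing.Theory Num.Theory.
Local Open Scope ring_scope.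

(** * Sums over permutations *)

(** The permutations sending [i] to [j] are the extensions of the permutations
    of the remaining indices; this turns the cosets of a point stabilizer into
    the terms of a Laplace expansion. *)
Lemma sum_perm_fixing (V : nmodType) (n : nat) (i j : 'I_n.+1)
    (F : 'S_n.+1 -> V) :
  \sum_(s : 'S_n.+1 | s i == j) F s = \sum_(t : 'S_n) F (lift_perm i j t).
Proof.
have lperm_inj : injective (@lift_perm n i j).
  move=> t u tu; apply/permP=> k; apply: (@lift_inj _ j).
  by rewrite -!(@lift_perm_lift _ i) tu.
have lift_onto (s : 'S_n.+1) : s i = j -> exists t, lift_perm i j t = s.
  move=> sij; pose f k := odflt k (unlift j (s (lift i k))).
  have fE k : lift j (f k) = s (lift i k).
    rewrite /f; case: unliftP => [m -> //|]; rewrite -sij => /perm_inj eq_i.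
    by have := neq_lift i k; rewrite eq_i eqxx.
  have f_inj : injective f.
    move=> k l fkl; apply: (@lift_inj _ i); apply: (@perm_inj _ s).
    by rewrite -!fE fkl.
  exists (perm f_inj); apply/permP=> k; case: (unliftP i k) => [m|] ->.
    by rewrite lift_perm_lift permE fE.
  by rewrite lift_perm_id.
rewrite (reindex (lift_perm i j)) => [|].
  by apply: eq_bigl => t; rewrite lift_perm_id eqxx.
exists (fun s => odflt 1%g [pick t | lift_perm i j t == s]) => [t _|s].
  by case: pickP => [u /eqP/lperm_inj //|/(_ t)]; rewrite eqxx.
move=> /eqP/lift_onto[t <-].
by case: pickP => [u /eqP //|/(_ t)]; rewrite eqxx.
Qed.

Lemma sum_perm2 (V : nmodType) (F : 'S_2 -> V) :
  \sum_s F s = F 1%g + F (tperm ord0 ord_max).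
Proof.
have I2 (j : 'I_2) : j = ord0 \/ j = ord_max.
  by case: j => [[|[|]]] // lt_j; [left|right]; apply: val_inj.
rewrite (bigD1 1%g) //= (bigD1 (tperm ord0 ord_max)) /=; last first.
  by apply/eqP=> /permP/(_ ord0); rewrite tpermL perm1.
rewrite big1 ?addr0 // => s /andP[/eqP s_N1 /eqP s_Nt].
have s_inj := @perm_inj _ s.
case: (I2 (s ord0)) => s0; case: (I2 (s ord_max)) => s1.
- by have := s_inj ord0 ord_max; rewrite s0 s1 => /(_ erefl).
- by case: s_N1; apply/permP=> j; case: (I2 j) => ->; rewrite perm1.
- by case: s_Nt; apply/permP=> j; case: (I2 j) => ->; rewrite ?tpermL ?tpermR.
- by have := s_inj ord0 ord_max; rewrite s0 s1 => /(_ erefl).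
Qed.

Definition lift_perm2 n (t : 'S_n) : 'S_n.+2 :=
  lift_perm ord0 ord0 (lift_perm ord0 ord0 t).

Lemma lift_perm2_0 n (t : 'S_n) : lift_perm2 n t ord0 = ord0.
Proof. exact: lift_perm_id. Qed.

Lemma lift_perm2_1 n (t : 'S_n) :
  lift_perm2 n t (lift ord0 ord0) = lift ord0 ord0.
Proof. by rewrite lift_perm_lift lift_perm_id. Qed.

Lemma lift_perm2_lift n (t : 'S_n) i :
  lift_perm2 n t (lift ord0 (lift ord0 i)) = lift ord0 (lift ord0 (t i)).
Proof. by rewrite !lift_perm_lift. Qed.

Lemma odd_lift_perm2 n (t : 'S_n) : lift_perm2 n t = t :> bool.
Proof. by rewrite !odd_lift_perm. Qed.

(** * Pfaffian sums *)

Section PfaffianSum.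
Context {T : Type} {S : comNzRingType}.
Implicit Types w : T -> T -> S.

Fixpoint pair_prod w (k : nat) : ('I_(k * 2) -> T) -> S :=
  match k return ('I_(k * 2) -> T) -> S with
  | 0 => fun=> 1
  | k'.+1 => fun v : 'I_(k' * 2).+2 -> T =>
      w (v ord0) (v (lift ord0 ord0))
      * pair_prod w k' (fun i => v (lift ord0 (lift ord0 i)))
  end.

Lemma pair_prodS w k (v : 'I_(k * 2).+2 -> T) :
  pair_prod w k.+1 v = w (v ord0) (v (lift ord0 ord0))
    * pair_prod w k (fun i => v (lift ord0 (lift ord0 i))).
Proof. by []. Qed.

(** For an alternating [w], this is [2 ^ k * k`!] times the Pfaffian of the
    matrix [w (v i) (v j)].
    Keeping the redundant terms avoids both division and a choice of
    representatives of the perfect matchings. *)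
Definition pfaffian_sum w (k : nat) (v : 'I_(k * 2) -> T) : S :=
  \sum_(s : 'S_(k * 2)) (-1) ^+ s * pair_prod w k (fun i => v (s i)).

(** The signed product is invariant under swapping the two arguments of a pair
    and under exchanging two pairs, and these moves are transitive on the
    indices. *)
Lemma pair_prod_to_front w k (j : 'I_(k * 2).+2) :
    (forall x y, w x y = - w y x) ->
  exists2 t : 'S_(k * 2).+2, t j = ord0 &
    forall v : 'I_(k * 2).+2 -> T,
      pair_prod w k.+1 (fun i => v (t i)) = (-1) ^+ t * pair_prod w k.+1 v.
Proof.
move=> w_anti; elim: k => [|k IH] in j *.
  have [j0|jN0] := eqVneq j ord0.
    by exists 1%g => [|v]; rewrite ?perm1 // odd_perm1 mul1r /= !perm1.
  have -> : j = lift ord0 ord0 by apply/val_inj; case: j jN0 => [[|[|]]].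
  exists (tperm (lift ord0 ord0) ord0) => [|v]; first by rewrite tpermL.
  by rewrite odd_tperm /= tpermL tpermR w_anti mulN1r mulNr.
case: (unliftP ord0 j) => [j'|] ->; last first.
  exists 1%g => [|v]; rewrite ?perm1 // odd_perm1 mul1r.
  by congr pair_prod; apply/funext=> i; rewrite perm1.
case: (unliftP ord0 j') => [j''|] ->; last first.
  exists (tperm (lift ord0 ord0) ord0) => [|v]; first by rewrite tpermL.
  rewrite odd_tperm mulN1r !(pair_prodS w k.+1) tpermL tpermR w_anti mulNr.
  congr (- (_ * pair_prod w _ _)); apply/funext=> i.
  by rewrite tpermD.
(* Bring [j] to the front of the remaining pairs, then exchange the first two
   pairs, which is an even permutation. *)
have [t tj tE] := IH j''.
pose o0 : 'I_(k.+1 * 2).+2 := ord0.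
pose o1 : 'I_(k.+1 * 2).+2 := lift ord0 ord0.
pose o2 : 'I_(k.+1 * 2).+2 := lift ord0 (lift ord0 (ord0 : 'I_(k * 2).+2)).
pose o3 : 'I_(k.+1 * 2).+2 :=
  lift ord0 (lift ord0 (lift ord0 ord0 : 'I_(k * 2).+2)).
exists (lift_perm2 (k.+1 * 2) t * (tperm o0 o2 * tperm o1 o3))%g => [|v].
  by rewrite !permM lift_perm2_lift tj tpermR tpermD.
have -> : (lift_perm2 (k.+1 * 2) t * (tperm o0 o2 * tperm o1 o3))%g = t :> bool.
  by rewrite !odd_permM odd_lift_perm2 !odd_tperm /= addbF.
rewrite (pair_prodS w k.+1) !permM lift_perm2_0 lift_perm2_1.
set q := (X in _ * X).
have -> : q = (-1) ^+ t * pair_prod w k.+1 (fun i =>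
    v (tperm o1 o3 (tperm o0 o2 (lift ord0 (lift ord0 i))))).
  rewrite -tE; congr pair_prod; apply/funext=> i; rewrite !permM.
  exact (congr1 (fun x => v (tperm o1 o3 (tperm o0 o2 x)))
    (lift_perm2_lift (k.+1 * 2) t i)).
rewrite mulrCA; congr (_ * _).
rewrite !pair_prodS [RHS]mulrCA.
congr (_ * (_ * _)).
- congr (w (v _) (v _)); first by rewrite tpermL tpermD.
  by rewrite [X in tperm _ _ X](@tpermD _ o0 o2 o1) // tpermL.
- congr (w (v _) (v _)); first by rewrite (@tpermR _ o0 o2) tpermD.
  by rewrite [X in tperm _ _ X](@tpermD _ o0 o2 o3) // tpermR.
congr pair_prod; apply/funext=> i.
by rewrite !tpermD.
Qed.

Lemma pfaffian_sum_perm w k (v : 'I_(k * 2) -> T) (t : 'S_(k * 2)) :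
  pfaffian_sum w k (fun i => v (t i)) = (-1) ^+ t * pfaffian_sum w k v.
Proof.
rewrite /pfaffian_sum (reindex_inj (mulIg t^-1%g)) big_distrr /=.
apply: eq_bigr => s _; rewrite odd_permM odd_permV addbC signr_addb -mulrA.
congr (_ * (_ * _)); congr pair_prod.
by apply/funext=> i; rewrite permM permKV.
Qed.

(** Laplace expansion along the first argument.  Each of the [k.+1 * 2]
    positions in which the first vector can occur contributes the same amount by
    [pair_prod_to_front], whence the factor; then one sorts the permutations by
    the index of the partner of the first vector. *)
Lemma pfaffian_sum_expand w k (v : 'I_(k * 2).+2 -> T) :
    (forall x y, w x y = - w y x) ->
  pfaffian_sum w k.+1 v = (k.+1 * 2)%:R *
    \sum_(j < (k * 2).+1) (-1) ^+ j * w (v ord0) (v (lift ord0 j))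
      * pfaffian_sum w k (fun i => v (lift ord0 (lift j i))).
Proof.
move=> w_anti; pose G (s : 'S_(k * 2).+2) : S :=
  (-1) ^+ s * pair_prod w k.+1 (fun i => v (s i)).
have GE : pfaffian_sum w k.+1 v = \sum_(s : 'S_(k * 2).+2) G s by [].
have front : \sum_(s : 'S_(k * 2).+2) G s =
    (k.+1 * 2)%:R * \sum_(s : 'S_(k * 2).+2 | s ord0 == ord0) G s.
  rewrite (partition_big (fun s : 'S_(k * 2).+2 => (s^-1)%g ord0) xpredT) //=.
  rewrite (eq_bigr (fun=> \sum_(s : 'S_(k * 2).+2 | s ord0 == ord0) G s)).
    by rewrite sumr_const card_ord [RHS]mulr_natl.
  move=> j _; have [t tj tE] := pair_prod_to_front w k j w_anti.
  rewrite (reindex_inj (mulgI t)) /=; apply: eq_big => [s|s _].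
    rewrite invMg permM -(can_eq (permK t)) permKV tj eq_sym.
    by rewrite (canF_eq (permK s)).
  have pE : pair_prod w k.+1 (fun i => v ((t * s)%g i)) =
      (-1) ^+ t * pair_prod w k.+1 (fun i => v (s i)).
    by rewrite -tE; congr pair_prod; apply/funext=> i; rewrite permM.
  by rewrite /G pE odd_permM signr_addb mulrACA -signr_addb addbb mul1r.
rewrite GE front sum_perm_fixing; congr (_ * _).
rewrite (partition_big (fun t : 'S_(k * 2).+1 => t ord0) xpredT) //=.
apply: eq_bigr => j _; rewrite sum_perm_fixing /pfaffian_sum big_distrr /=.
apply: eq_bigr => t _.
rewrite /G /= lift_perm_id !lift_perm_lift lift_perm_id !odd_lift_perm /=.
rewrite signr_addb signr_odd -!mulrA; congr (_ * _).
rewrite mulrCA; congr (_ * (_ * _)).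
by congr pair_prod; apply/funext=> i; rewrite !lift_perm_lift.
Qed.

(** The first index is given through its value because ['I_(k * 2)] has no
    canonical element for a variable [k]. *)
Lemma pfaffian_sum_orthogonal w k (v : 'I_(k * 2) -> T) (j : 'I_(k * 2)) :
    (forall x y, w x y = - w y x) ->
    nat_of_ord j = 0%N -> (forall i, i != j -> w (v j) (v i) = 0) ->
  pfaffian_sum w k v = 0.
Proof.
case: k => [|k] in v j *; first by case: j.
move=> w_anti j0 orth.
rewrite pfaffian_sum_expand // big1 ?mulr0 // => i _.
have -> : (ord0 : 'I_(k * 2).+2) = j by apply: val_inj.
rewrite [w _ _]orth ?mulr0 ?mul0r //.
by rewrite -val_eqE /= j0.
Qed.

(** Each [e a] is orthogonal to all other vectors of the frame but its partner
    [f a], so the expansion along the first argument has a single nonzero term, which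
    is a frame with one pair less.  The tuple interleaves the two families as
    [e 0, f 0, e 1, f 1, ...]. *)
Lemma pfaffian_sum_frame w k (e f : nat -> T) :
    (forall x y, w x y = - w y x) ->
    (forall a b, (a < k)%N -> (b < k)%N -> a != b -> w (e a) (e b) = 0) ->
    (forall a b, (a < k)%N -> (b < k)%N -> w (e a) (f b) = (a == b)%:R) ->
  pfaffian_sum w k (fun i => if odd i then f i./2 else e i./2)
    = (2 ^ k * k`!)%:R.
Proof.
move=> w_anti; elim: k => [|k IH] in e f *.
  move=> _ _; rewrite /pfaffian_sum (eq_bigr (fun=> 1)).
    by rewrite sumr_const card_Sn.
  move=> s _; have -> : s = 1%g by apply/permP; case.
  by rewrite odd_perm1 mul1r.
move=> ee ef.
rewrite pfaffian_sum_expand // (bigD1 ord0) //= big1 ?addr0 => [|j jN0].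
  rewrite expr0 mul1r ef // eqxx mul1r.
  rewrite [X in pfaffian_sum w k X](_ : _ = fun i : 'I_(k * 2) =>
    if odd i then (f \o succn) i./2 else (e \o succn) i./2); last first.
    by apply/funext=> i; rewrite negbK.
  rewrite IH.
  - by rewrite -natrM factS expnS [(k.+1 * 2)%N]mulnC mulnACA.
  - by move=> a b ak bk ab; apply: ee.
  - by move=> a b ak bk; rewrite ef.
have j_gt0 : (0 < j)%N by rewrite lt0n -val_eqE in jN0 *.
have hj : (uphalf j < k.+1)%N by rewrite ltnS leq_uphalf_double -muln2 -ltnS.
have hj0 : (0 == uphalf j)%N = false.
  by case: (nat_of_ord j) j_gt0 => // m _; rewrite uphalfS.
rewrite /= add0n; case: ifP => _.
  by rewrite ef // hj0 mulr0 mul0r.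
by rewrite ee // ?hj0 // mulr0 mul0r.
Qed.

End PfaffianSum.

Lemma pair_prod_scale {T : Type} {S : comNzRingType} (c : S)
    (w : T -> T -> S) k v :
  pair_prod (fun x y => c * w x y) k v = c ^+ k * pair_prod w k v.
Proof.
elim: k => [|k IH] in v *; first by rewrite mulr1.
by rewrite !pair_prodS IH exprS mulrACA.
Qed.

Lemma pfaffian_sum_scale {T : Type} {S : comNzRingType} (c : S)
    (w : T -> T -> S) k v :
  pfaffian_sum (fun x y => c * w x y) k v = c ^+ k * pfaffian_sum w k v.
Proof.
rewrite /pfaffian_sum big_distrr; apply: eq_bigr => s _.
by rewrite pair_prod_scale mulrCA.
Qed.

Lemma pair_prod_comp {T T' : Type} {S : comNzRingType} (f : T -> T')
    (w : T' -> T' -> S) k v :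
  pair_prod (fun x y => w (f x) (f y)) k v =
  pair_prod w k (fun i => f (v i)).
Proof. by elim: k => //= k IH in v *; rewrite IH. Qed.

Lemma pfaffian_sum_comp {T T' : Type} {S : comNzRingType} (f : T -> T')
    (w : T' -> T' -> S) k v :
  pfaffian_sum (fun x y => w (f x) (f y)) k v =
  pfaffian_sum w k (fun i => f (v i)).
Proof. by apply: eq_bigr => s _; rewrite pair_prod_comp. Qed.

Section Transfer.
Context {T : Type} {S : numDomainType}.
Implicit Types w : T -> T -> S.

Lemma pfaffian_sum_repeated w k (v : 'I_(k * 2) -> T) i j :
  i != j -> v i = v j -> pfaffian_sum w k v = 0.
Proof.
move=> ij vij; have := pfaffian_sum_perm w k v (tperm i j).
rewrite [X in pfaffian_sum _ _ X](_ : _ = v); last first.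
  by apply/funext=> l; case: tpermP => [->|->|].
by rewrite odd_tperm ij mulN1r => /eqP; rewrite eq_sym eqNr => /eqP.
Qed.

(** The expansion of the [k.+1]-st power of [w'] at [v i, y, v 0, v 1, ...] is
    zero because [v i] is repeated, and reduces to its first term because every
    other minor is a [k]-th power of [w] with [y] among its arguments. *)
Lemma pfaffian_sum_transfer w w' k (v : 'I_(k * 2) -> T) y :
    (forall x z, w x z = - w z x) -> (forall x z, w' x z = - w' z x) ->
    (forall u, pfaffian_sum w' k u = pfaffian_sum w k u) ->
    pfaffian_sum w k v != 0 -> (forall i, w y (v i) = 0) ->
  forall i, w' (v i) y = 0.
Proof.
case: k => [|k] in v * => w_anti w'_anti ww' vN0 y_orth i; first by case: i.
pose u (j : 'I_(k.+1 * 2).+2) :=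
  if unlift ord0 j is Some j1 then
    if unlift ord0 j1 is Some j2 then v j2 else y
  else v i.
have u0 : u ord0 = v i by rewrite /u unlift_none.
have u1 : u (lift ord0 ord0) = y by rewrite /u liftK unlift_none.
have uS j : u (lift ord0 (lift ord0 j)) = v j by rewrite /u !liftK.
have : pfaffian_sum w' k.+2 u = 0.
  apply: (@pfaffian_sum_repeated w' k.+2 u
    (ord0 : 'I_(k.+1 * 2).+2) (lift ord0 (lift ord0 i)) _ _) => //.
  by rewrite uS.
rewrite pfaffian_sum_expand // (bigD1 ord0) //= big1 ?addr0 => [|j jN0].
  rewrite expr0 mul1r u0 u1 ww'.
  rewrite [X in pfaffian_sum w _ X](_ : _ = v); last exact/funext.
  move/eqP; rewrite mulf_eq0 pnatr_eq0 /= mulf_eq0 (negPf vN0) orbF.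
  by move/eqP.
rewrite ww' [X in _ * X](_ : _ = 0) ?mulr0 //.
have j0 : lift j (ord0 : 'I_(k * 2).+2) = ord0.
  by apply: val_inj; rewrite /= /bump leqn0 -[_ == 0%N]/(j == ord0) (negPf jN0).
apply: (@pfaffian_sum_orthogonal _ _ _ k.+1 _ (ord0 : 'I_(k * 2).+2)) => //.
move=> m mN0.
rewrite j0 u1; case: (unliftP ord0 (lift j m)) => [m' ->|jm0].
  by rewrite uS y_orth.
by case/eqP: mN0; apply: (@lift_inj _ j); rewrite jm0 -j0.
Qed.

(** The preceding lemma with [v] the interleaving of [e] and [f], which sit at
    the even and at the odd positions. *)
Lemma frame_transfer w w' k (e f : nat -> T) y :
    (forall x z, w x z = - w z x) -> (forall x z, w' x z = - w' z x) ->
    (forall u, pfaffian_sum w' k u = pfaffian_sum w k u) ->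
    (forall a b, (a < k)%N -> (b < k)%N -> a != b -> w (e a) (e b) = 0) ->
    (forall a b, (a < k)%N -> (b < k)%N -> w (e a) (f b) = (a == b)%:R) ->
    (forall a, (a < k)%N -> w y (e a) = 0) ->
    (forall a, (a < k)%N -> w y (f a) = 0) ->
  forall a, (a < k)%N -> w' (e a) y = 0 /\ w' (f a) y = 0.
Proof.
move=> w_anti w'_anti ww' ee ef ye yf.
pose v (i : 'I_(k * 2)) := if odd i then f i./2 else e i./2.
have vN0 : pfaffian_sum w k v != 0.
  by rewrite pfaffian_sum_frame // pnatr_eq0 muln_eq0 expn_eq0 -lt0n fact_gt0.
have y_orth i : w y (v i) = 0.
  have ik : (i./2 < k)%N by rewrite ltn_half_double -muln2.
  by rewrite /v; case: ifP => _; [apply: yf|apply: ye].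
have tr := @pfaffian_sum_transfer w w' k v y w_anti w'_anti ww' vN0 y_orth.
move=> a ak.
have a0 : (a.*2 < k * 2)%N by rewrite muln2 ltn_double.
have a1 : (a.*2.+1 < k * 2)%N by rewrite muln2 ltn_Sdouble.
have := tr (Ordinal a0); have := tr (Ordinal a1).
by rewrite /v /= !odd_double /= doubleK uphalf_double.
Qed.

End Transfer.

(** * Wedge powers and the symplectic form in coordinates *)

Definition vpair {T : Type} (x y : T) (i : 'I_2) : T :=
  if i == ord0 then x else y.

(** In the wedge of [a] with its [k]-th power, the inner sum over permutations of
    the last [2k] arguments is absorbed by the outer sum, at the price of a
    factor [(2k)!] that the normalization cancels; a factor [1/2] remains for
    each wedge. *)
Lemma wedge_powE (R : realType) (m k : nat) (a : Defs.form R m 2) v :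
  wedge_pow a k v =
  (2 ^ k)%:R^-1 * pfaffian_sum (fun x y => a (vpair x y)) k v.
Proof.
elim: k => [|k IH] in v *.
  rewrite /pfaffian_sum (eq_bigr (fun=> 1)) => [|s _].
    by rewrite sumr_const card_Sn invr1 mul1r.
  have -> : s = 1%g by apply/permP; case.
  by rewrite odd_perm1 mul1r.
set w := fun x y => a (vpair x y).
pose n2 := (k * 2)%N.
pose G (s : 'S_n2.+2) : R := (-1) ^+ s * pair_prod w k.+1 (fun i => v (s i)).
have GE : pfaffian_sum w k.+1 v = \sum_(s : 'S_n2.+2) G s by [].
rewrite GE.
have -> : wedge_pow a k.+1 v = (2 * n2`!)%:R^-1 *
  \sum_(s : 'S_n2.+2) (-1) ^+ s
      * a (fun i : 'I_2 => v (s (lshift n2 i)))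
      * wedge_pow a k (fun j : 'I_n2 => v (s (rshift 2 j))) by [].
have shift2 (j : 'I_n2) : rshift 2 j = lift ord0 (lift ord0 j) :> 'I_n2.+2.
  exact: val_inj.
have step (s : 'S_n2.+2) : (-1) ^+ s
      * a (fun i : 'I_2 => v (s (lshift n2 i)))
      * wedge_pow a k (fun j : 'I_n2 => v (s (rshift 2 j))) =
    (2 ^ k)%:R^-1 * \sum_(t : 'S_n2) G (lift_perm2 n2 t * s)%g.
  rewrite IH mulrCA; congr (_ * _).
  rewrite /pfaffian_sum big_distrr; apply: eq_bigr => t _ /=.
  rewrite /G odd_permM odd_lift_perm2 signr_addb pair_prodS.
  rewrite !permM lift_perm2_0 lift_perm2_1 mulrCA -!mulrA; congr (_ * (_ * _)).
  congr (_ * _).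
    congr a; apply/funext=> i; rewrite /vpair; case: eqP => [->|iN0].
      by congr (v (s _)); apply: val_inj.
    congr (v (s _)); apply: val_inj; case: i iN0 => [[|[|]]] // ? iN0.
    by case: iN0; apply: val_inj.
  congr pair_prod; apply/funext=> i; rewrite permM shift2 //.
  by congr (v (s _)); rewrite lift_perm2_lift.
rewrite (eq_bigr _ (fun s _ => step s)) -big_distrr exchange_big /=.
rewrite (eq_bigr (fun=> \sum_(s : 'S_n2.+2) G s)) => [|t _]; last first.
  by rewrite [RHS](reindex_inj (mulgI (lift_perm2 n2 t))).
rewrite sumr_const card_Sn -[X in _ * (_ * X)]mulr_natl expnS !natrM.
have f0 : n2`!%:R != 0 :> R by rewrite pnatr_eq0 -lt0n fact_gt0.
by rewrite !invfM -!mulrA; congr (_ * _); rewrite mulrCA mulKf.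
Qed.

Section Omega.
Context {R : realType} {n : nat}.
Notation V := 'rV[R]_(n + n).
Implicit Types x y z : V.

Definition omega2 x y : R := omega R n (vpair x y).
Definition basis_x (i : 'I_n) : V := delta_mx 0 (lshift n i).
Definition basis_y (i : 'I_n) : V := delta_mx 0 (rshift n i).

Lemma omega2E x y :
  omega2 x y = \sum_(i < n) (x 0 (lshift n i) * y 0 (rshift n i)
                             - y 0 (lshift n i) * x 0 (rshift n i)).
Proof.
rewrite /omega2 /omega fct_sumE; apply: eq_bigr => i _.
rewrite /wedge invr1 mul1r sum_perm2 /dx /dy !perm1.
have l0 : @lshift 1 1 ord0 = ord0 :> 'I_2 by apply: val_inj.
have r0 : @rshift 1 1 ord0 = ord_max :> 'I_2 by apply: val_inj.
by rewrite l0 r0 tpermL tpermR odd_perm1 odd_tperm /= !mul1r mulN1r mulNr.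
Qed.

Lemma omega2_anti x y : omega2 x y = - omega2 y x.
Proof.
by rewrite !omega2E -sumrN; apply: eq_bigr => i _; rewrite opprB.
Qed.

Lemma omega2_linear a x x' y :
  omega2 (a *: x + x') y = a * omega2 x y + omega2 x' y.
Proof.
rewrite !omega2E big_distrr -big_split; apply: eq_bigr => i _ /=.
rewrite !mxE mulrDl mulrDr opprD addrACA !mulrA -mulrA mulrBr !mulrA.
by rewrite [y _ _ * a]mulrC.
Qed.

Lemma omega2_xx i j : omega2 (basis_x i) (basis_x j) = 0.
Proof.
by rewrite omega2E big1 // => k _; rewrite !mxE !eq_rlshift !andbF !mulr0 subrr.
Qed.

Lemma omega2_yy i j : omega2 (basis_y i) (basis_y j) = 0.
Proof.
by rewrite omega2E big1 // => k _; rewrite !mxE !eq_lrshift !andbF !mul0r subrr.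
Qed.

Lemma omega2_xy i j : omega2 (basis_x i) (basis_y j) = (i == j)%:R.
Proof.
rewrite omega2E (bigD1 i) //= big1 ?addr0 => [|k ki].
  by rewrite !mxE !eqxx eq_rshift eq_lrshift mul1r mul0r subr0.
by rewrite !mxE eq_lshift eq_lrshift (negPf ki) !mul0r subrr.
Qed.

End Omega.

(** * Alternating bilinear forms determined on a basis *)

Section Bilinear.
Context {R : comNzRingType} {m : nat}.
Notation V := 'rV[R]_m.
Implicit Types B : V -> V -> R.

Lemma linear_delta (L : V -> R) x :
    (forall a x x', L (a *: x + x') = a * L x + L x') ->
  L x = \sum_j x 0 j * L (delta_mx 0 j).
Proof.
move=> lin; have L0 : L 0 = 0.
  by have := lin (-1) 0 0; rewrite scaler0 addr0 mulN1r addNr.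
rewrite {1}(row_sum_delta x); elim/big_rec2: _ => // j _ y _ <-.
exact: lin.
Qed.

Lemma bilinear_delta_eq B B' :
    (forall x y, B x y = - B y x) -> (forall x y, B' x y = - B' y x) ->
    (forall a x x' y, B (a *: x + x') y = a * B x y + B x' y) ->
    (forall a x x' y, B' (a *: x + x') y = a * B' x y + B' x' y) ->
    (forall i j, B (delta_mx 0 i) (delta_mx 0 j)
                 = B' (delta_mx 0 i) (delta_mx 0 j)) ->
  forall x y, B x y = B' x y.
Proof.
move=> Ba B'a Bl B'l BB' x y.
rewrite (linear_delta (B^~ y)) // (linear_delta (B'^~ y)) //.
apply: eq_bigr => i _; congr (_ * _).
rewrite Ba B'a (linear_delta (B^~ _)) // (linear_delta (B'^~ _)) //.
by congr (- _); apply: eq_bigr => j _; rewrite BB'.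
Qed.
End Bilinear.

(** * Proportionality of the two forms *)

(** This is where [k < n] is used: a frame of [k] pairs indexed through [s] can
    start at any [q] and still miss the pair indexed by [p]. *)
Lemma enum_avoiding n k (p q : 'I_n) : (k <= n - 1)%N -> p != q ->
  exists s : nat -> 'I_n, [/\ s 0 = q, forall a, (a < k)%N -> s a != p
    & forall a b, (a < k)%N -> (b < k)%N -> (s a == s b) = (a == b)].
Proof.
move=> kn pq; pose l := q :: rem q (rem p (enum 'I_n)).
have p_in : p \in enum 'I_n by rewrite mem_enum.
have q_in : q \in rem p (enum 'I_n).
  by rewrite mem_rem_uniq ?enum_uniq // inE mem_enum eq_sym pq.
have l_size : (k <= size l)%N.
  have sz : size (rem p (enum 'I_n)) = (n - 1)%N.
    by rewrite size_rem // size_enum_ord subn1.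
  rewrite /= size_rem // prednK sz //.
  by rewrite -sz; case: (rem p _) q_in.
have l_uniq : uniq l.
  by rewrite /= mem_rem_uniqF ?rem_uniq ?enum_uniq.
have p_nin : p \notin l.
  rewrite inE negb_or pq; apply/negP=> /mem_rem.
  by rewrite mem_rem_uniqF ?enum_uniq.
exists (nth q l); split=> // [a ak|a b ak bk].
  by apply: contraNneq p_nin => <-; rewrite mem_nth // (leq_trans ak).
by rewrite nth_uniq // (leq_trans _ l_size).
Qed.

Lemma real_root_of_unity (R : realDomainType) (c : R) k :
    (0 < k)%N -> c ^+ k = 1 ->
  if odd k then c = 1 else c = 1 \/ c = -1.
Proof.
move=> k0 ck; have /eqP := congr1 Num.norm ck.
rewrite normrX normr1 pexpr_eq1 // => /eqP c1.
have [c_ge0|c_lt0] := leP 0 c.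
  by rewrite -(ger0_norm c_ge0) c1; case: ifP => //; left.
have cN1 : c = -1 by rewrite -c1 ltr0_norm // opprK.
case: ifP => [k_odd|]; last by right.
by move: ck c_lt0; rewrite cN1 -signr_odd k_odd expr1 => ->; rewrite ltr10.
Qed.

Section Assembly.
Context {R : realType} {n : nat}.
Notation V := 'rV[R]_(n + n).

Lemma omega2_linear_r a (x x' y : V) :
  omega2 y (a *: x + x') = a * omega2 y x + omega2 y x'.
Proof. by rewrite ![omega2 y _]omega2_anti omega2_linear opprD mulrN. Qed.

(** Transferring orthogonality through frames shows that the Gram matrix of [B]
    in the standard basis vanishes off the pairs [(ex p, ey p)] and is constant on
    them; [c] is that constant. *)
Lemma proportional_of_pfaffian_sum_eq k (B : V -> V -> R) :
    (0 < k)%N -> (k <= n - 1)%N ->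
    (forall x y, B x y = - B y x) ->
    (forall a x x' y, B (a *: x + x') y = a * B x y + B x' y) ->
    (forall v, pfaffian_sum B k v = pfaffian_sum omega2 k v) ->
  exists2 c : R, c ^+ k = 1 & forall x y, B x y = c * omega2 x y.
Proof.
move=> k0 kn Ba Bl BO.
have Blr a x x' y : B y (a *: x + x') = a * B y x + B y x'.
  by rewrite ![B y _]Ba Bl opprD mulrN.
have oyx i j : omega2 (@basis_y R n i) (basis_x j) = - (i == j)%:R.
  by rewrite omega2_anti omega2_xy eq_sym.
have BD x y z : B (x + y) z = B x z + B y z.
  by have := Bl 1 x y z; rewrite scale1r mul1r.
have BDr x y z : B z (x + y) = B z x + B z y.
  by have := Blr 1 x y z; rewrite scale1r mul1r.
have BNr x z : B z (- x) = - B z x.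
  have := Blr (-1) x 0 z; rewrite scaleN1r addr0 => ->.
  have : B z 0 = 0.
    by have := Blr (-1) 0 0 z; rewrite scaler0 addr0 mulN1r addNr.
  by move=> ->; rewrite addr0 mulN1r.
have oB x y z : omega2 (x - y) z = omega2 x z - omega2 y z :> R.
  by rewrite addrC -scaleN1r omega2_linear mulN1r addrC.
pose ex i : V := basis_x i; pose ey i : V := basis_y i.
(* Orthogonality to [ex p] or [ey p] is transferred through a standard frame
   that avoids [p] and starts at [q]. *)
have B_off p q : p != q ->
    [/\ B (ex q) (ex p) = 0, B (ey q) (ex p) = 0,
        B (ex q) (ey p) = 0 & B (ey q) (ey p) = 0].
  move=> pq; have [s [s0 sp s_inj]] := enum_avoiding n k p q kn pq.
  have tr y :=
    @frame_transfer _ _ omega2 B k (ex \o s) (ey \o s) y omega2_anti Ba BO.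
  have ee a b : (a < k)%N -> (b < k)%N -> a != b ->
      omega2 ((ex \o s) a) ((ex \o s) b) = 0 by rewrite omega2_xx.
  have ef a b : (a < k)%N -> (b < k)%N ->
      omega2 ((ex \o s) a) ((ey \o s) b) = (a == b)%:R.
    by move=> ak bk; rewrite omega2_xy s_inj.
  have [|a ak|] := tr (ex p) ee ef _ _ 0 k0.
  - by move=> a _; rewrite omega2_xx.
  - by rewrite omega2_xy eq_sym (negPf (sp _ ak)).
  rewrite /= s0 => -> ->.
  have [a ak||] := tr (ey p) ee ef _ _ 0 k0.
  - by rewrite oyx eq_sym (negPf (sp _ ak)) oppr0.
  - by move=> a _; rewrite omega2_yy.
  by rewrite /= s0 => -> ->.
(* The vector [ey q - ey p] is orthogonal to [ex p + ex q] and to [ey q], so to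
   the frame obtained by replacing [ex q] by [ex p + ex q]; transferring this
   compares the two diagonal entries. *)
have B_diag p q : B (ex q) (ey q) = B (ex p) (ey p).
  have [->//|pq] := eqVneq p q.
  have [s [s0 sp s_inj]] := enum_avoiding n k p q kn pq.
  have s_q a : (a < k)%N -> (s a == q) = (a == 0).
    by move=> ak; rewrite -s0 s_inj.
  pose e a := ((a == 0)%:R : R) *: ex p + ex (s a).
  have [a b ak bk ab|a b ak bk|a ak|a ak|] :=
    @frame_transfer _ _ omega2 B k e (ey \o s) (ey q - ey p) omega2_anti Ba BO
      _ _ _ _ 0 k0.
  - by rewrite omega2_linear !omega2_linear_r !omega2_xx !(mulr0, addr0).
  - rewrite omega2_linear !omega2_xy s_inj // [p == _]eq_sym (negPf (sp _ bk)).
    by rewrite mulr0 add0r.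
  - rewrite /e omega2_linear_r !oB !oyx eqxx [q == p]eq_sym (negPf pq).
    rewrite [q == _]eq_sym s_q // [p == _]eq_sym (negPf (sp _ ak)).
    by rewrite oppr0 add0r subr0 opprK mulr1 subrr.
  - by rewrite oB !omega2_yy subrr.
  have qp : q != p by rewrite eq_sym.
  have [_ _ B1 _] := B_off p q pq; have [_ _ B2 _] := B_off q p qp.
  rewrite /e eqxx scale1r s0 BD !BDr !BNr B1 B2 add0r subr0 => /eqP.
  by rewrite addrC subr_eq0 => /eqP.
have n0 : (0 < n)%N by apply: leq_trans k0 (leq_trans kn (leq_subr _ _)).
pose p0 := Ordinal n0; pose c := B (ex p0) (ey p0).
have Bxx (x : V) : B x x = 0.
  by apply/eqP; rewrite -eqNr -Ba.
have BcO x y : B x y = c * omega2 x y.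
  apply: (@bilinear_delta_eq _ _ B (fun x y => c * omega2 x y)) => //.
  - by move=> {}x {}y; rewrite omega2_anti mulrN.
  - by move=> a {}x x' {}y; rewrite omega2_linear mulrDr mulrCA.
  move=> i j; case: (split_ordP i) => {}i ->; case: (split_ordP j) => {}j ->.
  - rewrite -/(basis_x i) -/(basis_x j) omega2_xx mulr0.
    by have [<-//|ij] := eqVneq j i; have [->] := B_off _ _ ij.
  - rewrite -/(basis_x i) -/(basis_y j) omega2_xy.
    have [<-|ij] := eqVneq i j; first by rewrite mulr1 (B_diag p0).
    by rewrite mulr0; rewrite eq_sym in ij; have [_ _ ->] := B_off _ _ ij.
  - rewrite -/(basis_y i) -/(basis_x j) oyx.
    have [<-|ij] := eqVneq i j; first by rewrite mulrN1 Ba (B_diag p0).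
    by rewrite oppr0 mulr0; rewrite eq_sym in ij; have [_ ->] := B_off _ _ ij.
  - rewrite -/(basis_y i) -/(basis_y j) omega2_yy mulr0.
    by have [<-//|ij] := eqVneq j i; have [_ _ _ ->] := B_off _ _ ij.
exists c => //.
pose s a : 'I_n := odflt p0 (insub a).
have s_inj a b : (a < k)%N -> (b < k)%N -> (s a == s b) = (a == b).
  have kn' : (k <= n)%N by apply: leq_trans kn _; rewrite leq_subr.
  move=> ak bk; rewrite /s !insubT ?(leq_trans _ kn') //.
have := pfaffian_sum_frame omega2 k (ex \o s) (ey \o s) omega2_anti
  (fun a b _ _ _ => omega2_xx _ _).
set v := (X in pfaffian_sum _ _ X) => v_frame.
have vE : pfaffian_sum omega2 k v != 0.
  rewrite v_frame ?pnatr_eq0 ?muln_eq0 ?expn_eq0 -?lt0n ?fact_gt0 //.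
  by move=> a b ak bk; rewrite omega2_xy s_inj.
have BE : B = fun x y => c * omega2 x y.
  by apply/funext=> x; apply/funext=> y.
by apply: (mulIf vE); rewrite mul1r -pfaffian_sum_scale -BE BO.
Qed.

End Assembly.

Theorem theorem3p8 (R : realType) (n k : nat)
    (A : {linear 'rV[R]_(n + n) -> 'rV[R]_(n + n)}) :
  (1 <= k)%N -> (k <= n - 1)%N ->
  pullback A (wedge_pow (omega R n) k) = wedge_pow (omega R n) k ->
  (odd k -> pullback A (omega R n) = omega R n) /\
  (~~ odd k -> pullback A (omega R n) = omega R n \/
               pullback A (omega R n) = - omega R n).
Proof.
move=> k0 kn Ak.
have [|a x x' y|v|c ck cE] :=
  @proportional_of_pfaffian_sum_eq R n k (fun x y => omega2 (A x) (A y)) k0 kn.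
- by move=> x y; apply: omega2_anti.
- by rewrite linearP omega2_linear.
- have := congr1 (fun g => g v) Ak.
  rewrite /pullback !wedge_powE pfaffian_sum_comp; apply: mulfI.
  by rewrite invr_eq0 pnatr_eq0 expn_eq0.
have pb : pullback A (omega R n) = c *: (omega R n : _ -> R^o).
  apply/funext=> v.
  have vE : v = vpair (v ord0) (v ord_max).
    apply/funext=> i; rewrite /vpair; case: eqP => [->//|iN0]; congr v.
    by apply: val_inj; case: i iN0 => [[|[|]]] // ? []; apply: val_inj.
  have -> : pullback A (omega R n) v = omega2 (A (v ord0)) (A (v ord_max)).
    rewrite /pullback /omega2; congr (omega R n); apply/funext=> i.
    by rewrite [in LHS]vE /vpair; case: ifP.
  by rewrite cE /omega2 -vE.
have := real_root_of_unity R c k k0 ck; rewrite pb.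
case: ifP => k_odd; first by move=> ->; split=> // _; rewrite scale1r.
move=> c_eq; split=> // _.
by case: c_eq => ->; [left; rewrite scale1r|right; rewrite scaleN1r].
Qed.
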